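(* Let $K$ be a commutative integral domain with identity, $n\ge1$, and let $\mathcal F=\sum_{|\alpha|=0}^{\infty}a_\alpha D^\alpha$ ($a_\alpha\in K$) be a linear differential operator of infinite order on $K[x_1,\dots,x_n]'$ such that $a_0$ (the coefficient with $\alpha=(0,\dots,0)$) is an invertible element of $K$. Then the differential equation $\mathcal F u=\delta$ has the unique solution $\mathcal E=\mathcal F^{-1}\delta$ in $K[x_1,\dots,x_n]'$.
   Context: A copolynomial over $K$ is a $K$-linear map $T:K[x_1,\dots,x_n]\to K$; $K[x_1,\dots,x_n]'$ is the $K$-module of copolynomials, and $(T,p)$ denotes the value of $T$ at $p$. For $\alpha\in\mathbb N_0^n$, $|\alpha|=\sum_j\alpha_j$, $D^\alpha=\frac{\partial^{|\alpha|}}{\partial x_1^{\alpha_1}\cdots\partial x_n^{\alpha_n}}$, and $(D^\alpha T,p)=(-1)^{|\alpha|}(T,D^\alpha p)$. The operator $\mathcal F=\sum_{|\alpha|=0}^\infty a_\alpha D^\alpha$ acts by $(\mathcal F T,p)=\sum_{|\alpha|\le m}a_\alpha (D^\alpha T,p)$ where $m=\deg p$. The $\delta$-function is the copolynomial $(\delta,p)=p(0)$. $\mathcal F^{-1}$ denotes the inverse of $\mathcal F:K[x_1,\dots,x_n]'\to K[x_1,\dots,x_n]'$, which is bijective when $a_0$ is invertible. *)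

(* Defs.v *)
From HB Require Import structures.
From mathcomp Require Import all_boot all_order all_algebra.
From mathcomp Require Import ssrcomplements.
From mathcomp Require Export mpoly.
Set Implicit Arguments.
Unset Strict Implicit.
Unset Printing Implicit Defensive.

Import GRing.Theory.
Local Open Scope ring_scope.

Section Copolynomials.
Variables (K : idomainType) (n : nat).

Definition copoly := {scalar {mpoly K[n]}}.

Definition copolyD_fun (al : 'X_{1..n}) (T : copoly) (p : {mpoly K[n]}) : K :=
  (-1) ^+ mdeg al * T (p^`M[al]).

Lemma copolyD_is_scalar al T : scalar (copolyD_fun al T).
Proof.
by move=> c p q; rewrite /copolyD_fun linearP linearP /= mulrDr mulrCA.
Qed.

HB.instance Definition _ al T :=
  GRing.isLinear.Build K {mpoly K[n]} K *%R (copolyD_fun al T)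
    (copolyD_is_scalar al T).

Definition copolyD (al : 'X_{1..n}) (T : copoly) : copoly := copolyD_fun al T.

(* As [msize p] is [deg p + 1] (and [0] for [p = 0]), the index type
   ['X_{1..n < msize p}] is the set of multi-indices with [|al| <= deg p]. *)
Definition diffop_fun (a : 'X_{1..n} -> K) (T : copoly) (p : {mpoly K[n]}) : K :=
  \sum_(al : 'X_{1..n < msize p}) a al * copolyD al T p.

Lemma mderivm_msize_eq0 (al : 'X_{1..n}) (p : {mpoly K[n]}) :
  (msize p <= mdeg al)%N -> p^`M[al] = 0.
Proof.
move=> le_p_al; apply/mpolyP => m; rewrite mcoeff_mderivm mcoeff0.
rewrite memN_msupp_eq0 ?mul0rn //; apply: msize_mdeg_ge.
by rewrite (leq_trans le_p_al) // mdegD leq_addr.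
Qed.

Lemma diffop_fun_widen a T (p : {mpoly K[n]}) k : (msize p <= k)%N ->
  diffop_fun a T p = \sum_(al : 'X_{1..n < k}) a al * copolyD al T p.
Proof.
move=> le_pk; rewrite /diffop_fun.
pose F (al : 'X_{1..n}) := a al * copolyD al T p.
pose Ip : subFinType _ := 'X_{1..n < msize p}.
pose Ik : subFinType _ := 'X_{1..n < k}.
rewrite (big_sub_widen Ip Ik xpredT F) /=; last by move=> al /leq_trans; apply.
apply: big_rmcond => al; rewrite -leqNgt => le_p_al.
by rewrite /F /= /copolyD_fun mderivm_msize_eq0 // linear0 !mulr0.
Qed.

Lemma diffop_is_scalar a T : scalar (diffop_fun a T).
Proof.
move=> c p q; pose k := maxn (msize (c *: p + q)) (maxn (msize p) (msize q)).
rewrite !(@diffop_fun_widen a T _ k) ?leq_max ?leqnn ?orbT //.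
rewrite mulr_sumr -big_split /=; apply: eq_bigr => al _.
by rewrite -/(copolyD_fun _ _ _) linearP /= mulrDr mulrCA.
Qed.

HB.instance Definition _ a T :=
  GRing.isLinear.Build K {mpoly K[n]} K *%R (diffop_fun a T)
    (diffop_is_scalar a T).

Definition diffop (a : 'X_{1..n} -> K) (T : copoly) : copoly := diffop_fun a T.

Definition delta : copoly := meval (fun _ : 'I_n => 0 : K).

End Copolynomials.

Arguments delta {K n}.

(* Main.v *)
Require Import Defs.
From mathcomp Require Import all_boot all_order all_algebra.
From HB Require Import structures.
From Stdlib Require Import FunctionalExtensionality ProofIrrelevance.

(** A differential operator [diffop a] on copolynomials is the transpose of an
    operator [P] on polynomials, [P p = \sum_al (-1)^|al| a_al D^al p]: the sum
    is finite on each [p], and [diffop a T = T \o P].  So it suffices to show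
    that [P] is bijective; composition with [P^-1] then inverts [diffop a], and
    the unique solution of [diffop a u = delta] is [delta \o P^-1].

    Every [D^al] with [al <> 0] lowers the degree, so [P] acts on the
    coefficients of top degree as multiplication by [a_0]
    ([mcoeff_dualop_top]).  Since [a_0] is a unit, [P] kills no nonzero
    polynomial ([dualop_inj]), and [p - P (p / a_0)] has smaller degree than
    [p], so that preimages are found by induction on the degree
    ([dualop_surj]). *)

Set Implicit Arguments.
Unset Strict Implicit.
Unset Printing Implicit Defensive.

Import GRing.Theory.
Local Open Scope ring_scope.

(** Functional extensionality identifies the underlying functions, and proof
    irrelevance identifies the linearity proofs bundled with them. *)
Lemma scalar_ext (R : pzRingType) (V : lmodType R) (f g : {scalar V}) :
  f =1 g -> f = g.
Proof.
case: f g => f [[f0] [fZ]] [g [[g0] [gZ]]] /= /functional_extensionality eq_fg.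
move: eq_fg f0 fZ g0 gZ => /= -> f0 fZ g0 gZ.
by rewrite (proof_irrelevance _ f0 g0) (proof_irrelevance _ fZ gZ).
Qed.

Lemma msize_leP (R : nzRingType) n (p : {mpoly R[n]}) k :
  (forall m, (k <= mdeg m)%N -> p@_m = 0) -> (msize p <= k)%N.
Proof.
move=> p0; rewrite msizeE; apply/bigmax_leqP_seq => m m_p _.
by rewrite ltnNge; apply: contraL m_p => /p0 p_m0; rewrite mcoeff_msupp p_m0 eqxx.
Qed.

Section DualOperator.
Variables (K : idomainType) (n : nat) (a : 'X_{1..n} -> K).
Implicit Types p q : {mpoly K[n]}.

Definition dualop p : {mpoly K[n]} :=
  \sum_(al : 'X_{1..n < msize p}) (a al * (-1) ^+ mdeg al) *: p^`M[al].

Lemma diffopE (T : copoly K n) p : diffop a T p = T (dualop p).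
Proof.
rewrite linear_sum; apply: eq_bigr => al _.
by rewrite linearZ /= /copolyD_fun mulrA.
Qed.

(** Taking a coefficient is itself a copolynomial, so the linearity of
    [diffop a T] in its argument passes to [dualop], one coefficient at a
    time. *)
Lemma dualop_is_linear : linear dualop.
Proof.
move=> c p q; apply/mpolyP => m.
have cE r : (dualop r)@_m = diffop a (mcoeff m : copoly K n) r.
  by rewrite diffopE.
by rewrite mcoeffD mcoeffZ !cE linearP.
Qed.

HB.instance Definition _ :=
  GRing.isLinear.Build K {mpoly K[n]} {mpoly K[n]} *:%R dualop dualop_is_linear.

(** In degrees at least [deg p], a derivative [D^al p] with [al <> 0] has no
    coefficient: it would come from one of [p] in degree above [deg p]. *)
Lemma mcoeff_dualop_top p m :
  (msize p <= (mdeg m).+1)%N -> (dualop p)@_m = a 0%MM * p@_m.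
Proof.
move=> le_p_m.
have [-> | p_neq0] := eqVneq p 0; first by rewrite linear0 !mcoeff0 mulr0.
have ltp0 : (mdeg (0%MM : 'X_{1..n}) < msize p)%N.
  by rewrite mdeg0 lt0n msize_poly_eq0.
rewrite /dualop raddf_sum /= (bigD1 (BMultinom ltp0)) //= big1 => [|al al_neq0].
  by rewrite mdeg0 expr0 mulr1 mderivm0m addr0 mcoeffZ.
have al_gt0 : (0 < mdeg al)%N.
  by rewrite lt0n mdeg_eq0; apply: contraNneq al_neq0 => al0; apply/eqP/val_inj.
rewrite mcoeffZ mcoeff_mderivm [p@__]memN_msupp_eq0 ?mul0rn ?mulr0 //.
apply: msize_mdeg_ge; apply: leq_trans le_p_m _.
by rewrite mdegD -addn1 addnC leq_add2r.
Qed.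

Hypothesis a0_unit : a 0%MM \is a GRing.unit.

Lemma dualop_inj : injective dualop.
Proof.
apply: raddf_inj => p Pp0; apply/eqP/negPn/negP => p_neq0.
have /esym/eqP : (dualop p)@_(mlead p) = a 0%MM * mleadc p.
  by apply: mcoeff_dualop_top; rewrite mlead_deg.
rewrite Pp0 mcoeff0 mulf_eq0 mleadc_eq0 (negPf p_neq0) orbF => /eqP a00.
by move: a0_unit; rewrite a00 unitr0.
Qed.

Lemma dualop_surj p : exists q, dualop q == p.
Proof.
have [k] := ubnPleq (msize p).
elim: k p => [|k IHk] p le_p.
  by exists 0; rewrite linear0 eq_sym -msize_poly_eq0 -leqn0.
(* [dualop q] has the same top-degree coefficients as [p]. *)
pose q := (a 0%MM)^-1 *: p.
case: (IHk (p - dualop q)) => [|r /eqP Pr].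
  apply: msize_leP => m le_k_m; rewrite mcoeffB mcoeff_dualop_top.
    by rewrite mcoeffZ mulVKr ?subrr.
  by rewrite (leq_trans (msizeZ_le _ _)) // (leq_trans le_p).
by exists (r + q); rewrite linearD /= Pr subrK.
Qed.

Definition dualop_inv p : {mpoly K[n]} := xchoose (dualop_surj p).

Lemma dualop_invK : cancel dualop_inv dualop.
Proof. by move=> p; apply/eqP/(xchooseP (dualop_surj p)). Qed.

Lemma dualopK : cancel dualop dualop_inv.
Proof. exact: inj_can_sym dualop_invK dualop_inj. Qed.

HB.instance Definition _ :=
  GRing.isLinear.Build K {mpoly K[n]} {mpoly K[n]} *:%R dualop_inv
    (can2_linear dualopK dualop_invK).

Definition diffop_inv (T : copoly K n) : copoly K n := T \o dualop_inv.

Lemma diffopK : cancel (diffop a) diffop_inv.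
Proof.
by move=> T; apply: scalar_ext => p; rewrite /= -/(diffop a T _) diffopE dualop_invK.
Qed.

Lemma diffop_invK : cancel diffop_inv (diffop a).
Proof. by move=> T; apply: scalar_ext => p; rewrite diffopE /= dualopK. Qed.

End DualOperator.

Theorem corollary5p2 (K : idomainType) (n : nat) (hn : (0 < n)%N)
    (a : 'X_{1..n} -> K) (ha0 : a 0%MM \is a GRing.unit) :
  exists Finv : copoly K n -> copoly K n,
    [/\ cancel (diffop a) Finv, cancel Finv (diffop a)
      & unique (fun u : copoly K n => diffop a u = delta) (Finv delta)].
Proof.
exists (diffop_inv ha0); split; [exact: diffopK | exact: diffop_invK | split].
  exact: diffop_invK.
by move=> u <-; rewrite diffopK.
Qed.
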